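(* Let $n\geqslant 2$, let $x_1,\ldots,x_{n-1}>0$ be real numbers, and put \[ u_i=x_i^{-1}\quad(i<n),\qquad u_n=-\Bigl(\sum_{i<n}x_i\Bigr)^{-1},\qquad \mathbf u=(u_1,\ldots,u_n), \] \[ \omega=\sum_{i<n}x_i^2+\sum_{i<j<n}x_ix_j,\qquad \mathcal T=\Bigl(\sum_{i<n}x_i\Bigr)\sum_{i<n}x_i(i\,n)-\sum_{i<j<n}x_ix_j(i\,j)\in\mathbb C[\mathfrak S_n]. \] Then, in $\mathbb C[\mathfrak S_n]$, \[ -\frac{1}{u_1\cdots u_n}\,\mathscr P^{(2,2)}(\mathbf u)=\omega^2\,1-\mathcal T^2 . \]
   Context: Here $1$ is the identity of $\mathbb C[\mathfrak S_n]$ and $(i\,j)$ denotes a transposition. Let $[n]=\{1,\ldots,n\}$ and for $X\subseteq[n]$ regard $\mathfrak S_X$ as the subgroup of $\mathfrak S_n$ fixing the complement of $X$. For a partition $\lambda\vdash k$, let $\chi^\lambda$ be the character of the complex Specht module $S^\lambda$ (so $S^{(k)}$ is trivial and $S^{(1^k)}$ is sign). For $\mathbf u=(u_1,\ldots,u_n)\in\mathbb C^n$, the universal Plücker coordinate is \[ \mathscr P^\lambda(\mathbf u)=\sum_{\substack{X\subseteq[n]\\|X|=k}}\Bigl(\sum_{\sigma\in\mathfrak S_X}\chi^\lambda(\sigma)\sigma\Bigr)\prod_{a\in[n]\setminus X}u_a\in\mathbb C[\mathfrak S_n],\] with $\mathscr P^\lambda(\mathbf u)=0$ when $k>n$ (so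 $\mathscr P^{(2,2)}(\mathbf u)=0$ when $n<4$). *)

(* Defs.v *)
From HB Require Import structures.
From mathcomp Require Import all_boot all_order all_algebra all_fingroup.
From mathcomp Require Import mxrepresentation.

Set Implicit Arguments.
Unset Strict Implicit.
Unset Printing Implicit Defensive.

Import GRing.Theory.
Local Open Scope ring_scope.

(* The group algebra K[G] is an alias of {ffun G -> K}, because {ffun G -> K}
   itself already carries the pointwise product. *)
Definition group_alg (K : comNzRingType) (gT : finGroupType) : Type :=
  {ffun gT -> K}.

HB.instance Definition _ (K : comNzRingType) (gT : finGroupType) :=
  GRing.Lmodule.copy (group_alg K gT) {ffun gT -> K^o}.

(* A group element, viewed as an element of the group algebra. *)
Definition galg_of (K : comNzRingType) (gT : finGroupType) (g : gT) :
    group_alg K gT :=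
  [ffun h => (h == g)%:R].
Arguments galg_of K {gT} g.

(* The convolution product: galg_mul (galg_of K g) (galg_of K h) is
   galg_of K (g * h)%g.  In {perm T} the product (s * t)%g is "s, then t". *)
Definition galg_mul (K : comNzRingType) (gT : finGroupType)
    (a b : group_alg K gT) : group_alg K gT :=
  [ffun g : gT => \sum_(h : gT) a h * b (h^-1 * g)%g].

Section GroupAlgebraRing.
Variables (K : comNzRingType) (gT : finGroupType).
Implicit Types (a b c : group_alg K gT) (g h : gT).
Let one : group_alg K gT := galg_of K 1%g.

Fact galg_mulA : associative (@galg_mul K gT).
Proof.
move=> a b c; apply/ffunP=> g; rewrite !ffunE.
under [RHS]eq_bigr => h _ do rewrite ffunE mulr_suml.
rewrite exchange_big /=; apply: eq_bigr => k _.
rewrite ffunE mulr_sumr (reindex_inj (mulgI k^-1%g)) /=; apply: eq_bigr => h _.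
by rewrite mulrA invMg invgK -mulgA mulKVg.
Qed.

Fact galg_mul1l : left_id one (@galg_mul K gT).
Proof.
move=> a; apply/ffunP=> g; rewrite ffunE (bigD1 1%g) //= ffunE eqxx mul1r.
rewrite invg1 mul1g big1 ?addr0 // => h /negPf ne_h1.
by rewrite ffunE ne_h1 mul0r.
Qed.

Fact galg_mul1r : right_id one (@galg_mul K gT).
Proof.
move=> a; apply/ffunP=> g; rewrite ffunE (bigD1 g) //= ffunE mulVg eqxx mulr1.
rewrite big1 ?addr0 // => h ne_hg; rewrite ffunE -eq_mulVg1.
by rewrite (negPf ne_hg) mulr0.
Qed.

Fact galg_mulDl : left_distributive (@galg_mul K gT) +%R.
Proof.
move=> a b c; apply/ffunP=> g; rewrite !ffunE -big_split.
by apply: eq_bigr => h _; rewrite ffunE mulrDl.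
Qed.

Fact galg_mulDr : right_distributive (@galg_mul K gT) +%R.
Proof.
move=> a b c; apply/ffunP=> g; rewrite !ffunE -big_split.
by apply: eq_bigr => h _; rewrite ffunE mulrDr.
Qed.

Fact galg_oner_neq0 : one != 0.
Proof.
by apply/eqP=> /ffunP/(_ 1%g)/eqP; rewrite !ffunE eqxx oner_eq0.
Qed.

HB.instance Definition _ := GRing.Zmodule_isNzRing.Build (group_alg K gT)
  galg_mulA galg_mul1l galg_mul1r galg_mulDl galg_mulDr galg_oner_neq0.

Fact galg_scaleAl (k : K) a b : k *: (a * b) = (k *: a) * b.
Proof.
apply/ffunP=> g; rewrite !ffunE scaler_sumr.
by apply: eq_bigr => h _; rewrite ffunE scalerAl.
Qed.

HB.instance Definition _ :=
  GRing.Lmodule_isLalgebra.Build K (group_alg K gT) galg_scaleAl.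

Fact galg_scaleAr (k : K) a b : k *: (a * b) = a * (k *: b).
Proof.
apply/ffunP=> g; rewrite !ffunE scaler_sumr.
by apply: eq_bigr => h _; rewrite ffunE scalerAr.
Qed.

HB.instance Definition _ :=
  GRing.Lalgebra_isAlgebra.Build K (group_alg K gT) galg_scaleAr.

End GroupAlgebraRing.

(* Integer partitions: weakly decreasing sequences of positive integers. *)
Record intpart := IntPart {
  parts :> seq nat;
  _ : sorted geq parts && (0%N \notin parts)
}.

Definition part22 : intpart := @IntPart [:: 2; 2] isT.

(* The Specht module of shape lam, as a module over the group Sym X of
   permutations of T fixing the complement of X; it is meant for
   #|X| = sumn lam.  The tableau t of shape lam used below is filled with the
   elements of X, in the order of enum X, row by row.  Modules are right
   modules, acting on row vectors. *)
Section Specht.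
Variables (F : fieldType) (T : finType) (lam : intpart) (X : {set T}).

Definition tab_row (x : T) : nat := reshape_index lam (index x (enum X)).
Definition tab_col (x : T) : nat := reshape_offset lam (index x (enum X)).

Definition row_stab : {set {perm T}} :=
  [set s in Sym X | [forall x in X, tab_row (s x) == tab_row x]].
Definition col_stab : {set {perm T}} :=
  [set s in Sym X | [forall x in X, tab_col (s x) == tab_col x]].

Let aG := regular_repr F (Sym X).

(* Let a be the sum of row_stab and b the signed sum of col_stab.  The right
   ideal a F[Sym X] is the permutation module on the tabloids of shape lam
   (the right cosets of row_stab), and the vector a b is the polytabloid
   of t. *)
Definition polytabloid : 'rV[F]_#|Sym X| :=
  gring_row ((\sum_(p in row_stab) aG p)
             *m (\sum_(q in col_stab) (-1) ^+ odd_perm q *: aG q)).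

Definition specht_mod : 'M[F]_#|Sym X| := cyclic_mx aG polytabloid.

Definition specht_repr : mx_representation F (Sym X) (\rank specht_mod) :=
  submod_repr (cyclic_mx_module aG polytabloid).

Definition specht_char (s : {perm T}) : F := \tr (specht_repr s).

End Specht.

(* The sum over X is empty when n < sumn lam. *)
Definition plucker (F : fieldType) (lam : intpart) (n : nat) (u : 'I_n -> F) :
    group_alg F 'S_n :=
  \sum_(X : {set 'I_n} | #|X| == sumn lam)
     (\prod_(a in ~: X) u a) *:
       \sum_(s in Sym X) specht_char F lam X s *: galg_of F s.

(* In dimension n = m.+1, the indices i < n are the
   lift ord_max i (of value i) for i : 'I_m, and the index n is ord_max. *)
Definition upoint (F : fieldType) (m : nat) (x : 'I_m -> F) (a : 'I_m.+1) : F :=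
  if unlift ord_max a is Some i then (x i)^-1 else - (\sum_(i < m) x i)^-1.

Definition omega (F : fieldType) (m : nat) (x : 'I_m -> F) : F :=
  \sum_(i < m) x i ^+ 2 + \sum_(i < m) \sum_(j < m | (i < j)%N) x i * x j.

Definition transp_elt (F : fieldType) (m : nat) (x : 'I_m -> F) :
    group_alg F 'S_m.+1 :=
  (\sum_(i < m) x i) *:
     (\sum_(i < m) x i *: galg_of F (tperm (lift ord_max i) ord_max))
  - \sum_(i < m) \sum_(j < m | (i < j)%N)
       (x i * x j) *: galg_of F (tperm (lift ord_max i) (lift ord_max j)).

(* Main.v *)
(* Put y_a = 1 / u_a, so that sum_a y_a = 0, and let t_ab be the transposition
   (a b).  Then the element T is -sum_(a<b) y_a y_b t_ab and omega is half the
   power sum p_2(y).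

   The module generated by a vector v of the regular module with v v = c v,
   c <> 0, is the image of the projection x |-> c^-1 v x; computing traces, the
   element sum_s chi(s) s is c^-1 times the sum over g of the conjugates by g of
   the element v with every group element inverted.  For the Young symmetrizer
   of shape (2,2) one has c = 12, so P^(2,2)(u) / (u_1 ... u_n) is 1/12 times a
   sum over quadruples of distinct indices of
     y_a y_b y_c y_d (1 - t_bd)(1 - t_ac)(1 + t_cd)(1 + t_ab),
   and no character value is ever needed.  Renaming the indices, the odd terms
   cancel and there remain the identity, the terms t_ab t_cd and the 3-cycles
   t_ab t_bc.  The same kinds of terms make up T^2, sorted by the coincidences
   among the four indices, and sum_a y_a = 0 removes every index that does not
   occur in the group element. *)
Require Import Defs.
From mathcomp Require Import all_boot all_order all_algebra all_fingroup.
From mathcomp Require Import mxrepresentation ring.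
From mathcomp Require Import reals complex.

Set Implicit Arguments.
Unset Strict Implicit.
Unset Printing Implicit Defensive.

Import GRing.Theory Num.Theory.
Local Open Scope ring_scope.

(** * Characters of cyclic submodules of the regular module *)

(** [P] has its image in [U] and fixes [U] pointwise, so it is a projection onto [U]. It factors
    through the inclusion [B] of [U], and moving [B] around the trace leaves the action of [s] on
    [U]. *)
Lemma mxtrace_submod (F : fieldType) (gT : finGroupType) (G : {group gT})
    (n : nat) (rG : mx_representation F G n) (U P : 'M[F]_n)
    (Umod : mxmodule rG U) (s : gT) :
  (P <= U)%MS -> U *m P = U -> s \in G ->
  \tr (submod_repr Umod s) = \tr (P *m rG s).
Proof.
move=> sPU UP Gs.
pose B := @val_submod _ _ U _ 1%:M; pose C := in_submod U (1%:M : 'M[F]_n).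
have BP m (V : 'M_(m, n)) : (V <= U)%MS -> V *m P = V.
  by case/submxP=> D ->; rewrite -mulmxA UP.
have sBU : (B <= U)%MS by rewrite val_submodP.
have sBsU : (B *m rG s <= U)%MS by apply: mxmodule_trans.
have -> : submod_repr Umod s = B *m rG s *m C :> 'M_(\rank U).
  by rewrite /= /submod_mx in_submodE.
have PE : P = P *m C *m B.
  by rewrite -{1}(in_submodK sPU) val_submodE in_submodE.
rewrite [in RHS]PE -(mulmxA (P *m C)) [RHS]mxtrace_mulC.
by rewrite [in RHS]mulmxA (BP _ _ sBsU).
Qed.

Section RegularCyclic.
Variables (F : fieldType) (gT : finGroupType) (G : {group gT}).
Local Notation aG := (regular_repr F G).
Implicit Type v : 'rV[F]_#|G|.

(** The matrix of left multiplication by [v] on the group algebra, acting on row vectors: row [i]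
    holds the product of [v] with the [i]-th group element. *)
Definition left_mul_mx v : 'M[F]_#|G| :=
  \matrix_i (v *m aG (enum_val i)).

Lemma mul_left_mul_mx v (u : 'rV_#|G|) :
  u *m left_mul_mx v = v *m gring_mx aG u.
Proof.
rewrite /gring_mx /= [u *m enveloping_algebra_mx _]mulmx_sum_row linear_sum mulmx_sumr.
rewrite mulmx_sum_row; apply: eq_bigr => i _.
by rewrite rowK linearZ /= rowK mxvecK -scalemxAr.
Qed.

Lemma regular_mxE v (t g : gT) : t \in G -> g \in G ->
  (v *m aG t) 0 (gring_index G g) = v 0 (gring_index G (g * t^-1)%g).
Proof.
move=> Gt Gg; rewrite mxE (bigD1 (gring_index G (g * t^-1)%g)) //=.
rewrite !mxE eqxx /= gring_indexK ?groupM ?groupV // mulgKV eqxx mulr1.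
rewrite big1 ?addr0 // => i ne_i; rewrite !mxE eqxx /=.
case: eqP => [eq_g|]; last by rewrite mulr0.
case/eqP: ne_i; rewrite -(gring_valK i); congr (gring_index G _).
have /(congr1 enum_val) := eq_g.
rewrite !gring_indexK ?groupM ?enum_valP // => ->.
by rewrite mulgK.
Qed.

(** As [v v = c v], left multiplication by [c^-1 v] is a projection onto the right ideal of [v]. Its
    composite with right multiplication by [s] sends [g] to [c^-1 v g s], where [g] has the
    coefficient of [v] at [g s^-1 g^-1], up to [c^-1]. *)
Lemma mxtrace_cyclic_regular v (c : F) (s : gT) : c != 0 ->
  v *m gring_mx aG v = c *: v -> s \in G ->
  \tr (submod_repr (cyclic_mx_module aG v) s)
    = c^-1 * \sum_(g in G) v 0 (gring_index G (g * s^-1 * g^-1)%g).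
Proof.
move=> nz_c vv Gs; rewrite (@mxtrace_submod _ _ _ _ _ _ (c^-1 *: left_mul_mx v)) //.
- rewrite -scalemxAl mxtraceZ; congr (_ * _); rewrite /mxtrace.
  rewrite [RHS]big_enum_val; apply: eq_bigr => i _.
  have Gi : enum_val i \in G by apply: enum_valP.
  transitivity ((row i (left_mul_mx v) *m aG s) 0 i).
    by rewrite -row_mul [in RHS]mxE.
  rewrite rowK -mulmxA -repr_mxM // -{2}(gring_valK i) regular_mxE ?groupM //.
  by rewrite invMg mulgA.
- rewrite scalemx_sub //; apply/row_subP=> i; rewrite rowK.
  by apply/cyclic_mxP; exists (aG (enum_val i)); rewrite ?envelop_mx_id ?enum_valP.
- apply/row_matrixP=> i; rewrite row_mul -scalemxAr mul_left_mul_mx //.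
  have /cyclic_mxP[A EA ->] := row_sub i (cyclic_mx aG v).
  have [b ->] : exists b, A = gring_mx aG b.
    by case/submxP: EA => b /(canRL mxvecK) ->; exists b.
  by rewrite gring_mxA mulmxA vv -scalemxAl scalerA mulVf ?scale1r.
Qed.

Lemma sum_character_cyclic_regular v (c : F) : c != 0 ->
  v *m gring_mx aG v = c *: v ->
  \sum_(s in G) \tr (submod_repr (cyclic_mx_module aG v) s) *: galg_of F s
    = c^-1 *: \sum_(g in G) \sum_(t in G)
        v 0 (gring_index G t) *: galg_of F ((t^-1)%g ^ g)%g.
Proof.
move=> nz_c vv.
under eq_bigr => s Gs do
  rewrite (mxtrace_cyclic_regular nz_c vv Gs) -scalerA scaler_suml.
rewrite -scaler_sumr exchange_big /=; congr (_ *: _).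
apply: eq_bigr => g Gg.
(* The substitution is [t = g s^-1 g^-1], that is, [s = (t^-1) ^ g]. *)
rewrite [RHS](reindex_inj invg_inj) /= [RHS](reindex_inj (conjg_inj g^-1%g)) /=.
apply: eq_big => [s|s Gs]; first by rewrite groupV groupJr ?groupV.
by rewrite invgK conjgKV -conjVg conjgE invgK mulgA.
Qed.

End RegularCyclic.

(** [A] is the Young symmetrizer acting in the regular representation, and the polytabloid is its
    row of coefficients. Hence [A A = c A] is the quasi-idempotence required of the generator of the
    Specht module. *)
Lemma sum_specht_char (F : fieldType) (T : finType) (lam : intpart)
    (X : {set T}) (c : F) :
  let aG := regular_repr F (Sym X) in
  let A := \sum_(p in row_stab lam X) \sum_(q in col_stab lam X)
             (-1) ^+ odd_perm q *: aG (p * q)%g in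
  c != 0 -> A *m A = c *: A ->
  \sum_(s in Sym X) specht_char F lam X s *: galg_of F s
    = c^-1 *: \sum_(g in Sym X)
        \sum_(p in row_stab lam X) \sum_(q in col_stab lam X)
          (-1) ^+ odd_perm q *: galg_of F (((p * q)^-1)%g ^ g)%g.
Proof.
move=> aG A nz_c AA.
have sRS p : p \in row_stab lam X -> p \in Sym X by rewrite inE => /andP[].
have sCS q : q \in col_stab lam X -> q \in Sym X by rewrite inE => /andP[].
have polyE : polytabloid F lam X = gring_row A.
  rewrite /polytabloid mulmx_suml; congr gring_row; apply: eq_bigr => p Rp.
  rewrite mulmx_sumr; apply: eq_bigr => q Cq.
  by rewrite -scalemxAr repr_mxM ?(sRS p) ?(sCS q).
have gmxA : gring_mx aG (polytabloid F lam X) = A.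
  rewrite polyE -gring_opE !linear_sum; apply: eq_bigr => p Rp.
  rewrite linear_sum; apply: eq_bigr => q Cq.
  by rewrite linearZ /= gring_opG // groupM ?(sRS p) ?(sCS q).
rewrite (@sum_character_cyclic_regular _ _ _ _ c) //; last first.
  by rewrite gmxA polyE -gring_row_mul AA linearZ.
congr (_ *: _); apply: eq_bigr => g Gg.
have vE t : t \in Sym X -> polytabloid F lam X 0 (gring_index [group of Sym X] t)
   = \sum_(p in row_stab lam X) \sum_(q in col_stab lam X)
       (-1) ^+ odd_perm q * (t == (p * q)%g)%:R.
  move=> Gt; rewrite polyE !linear_sum summxE; apply: eq_bigr => p Rp.
  rewrite linear_sum summxE; apply: eq_bigr => q Cq.
  rewrite linearZ mxE /=; congr (_ * _). rewrite /gring_row /regular_mx rowK.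
  rewrite gring_indexK ?group1 // mul1g mxE eqxx /=.
  rewrite -(inj_in_eq (can_in_inj (gring_indexK (G := [group of Sym X])))) //.
  by rewrite groupM ?(sRS p) ?(sCS q).
under eq_bigr => t Gt do rewrite vE // scaler_suml.
rewrite exchange_big; apply: eq_bigr => p Rp /=.
under eq_bigr => t Gt do rewrite scaler_suml.
rewrite exchange_big; apply: eq_bigr => q Cq /=.
have Gpq : (p * q)%g \in Sym X by rewrite groupM ?(sRS p) ?(sCS q).
rewrite (bigD1 (p * q)%g) //= eqxx mulr1 big1 ?addr0 // => t /andP[_ /negPf ->].
by rewrite mulr0 scale0r.
Qed.

(** * The Young symmetrizer of shape (2,2) *)

(** Here [p1], [p2] are the row transpositions and [q1], [q2] the column transpositions. Of the 16
    terms of [B A], the four [q_i p_j] vanish between [A] and [B]; each of the other 12 is absorbed,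
    with its sign, and leaves one copy of [A B]. *)
Lemma young_symmetrizer22_sq (R : pzRingType) (p1 p2 q1 q2 : R) :
  p1 * p1 = 1 -> p2 * p2 = 1 -> q1 * q1 = 1 -> q2 * q2 = 1 ->
  p1 * p2 = p2 * p1 -> q1 * q2 = q2 * q1 ->
  p1 * q1 * p1 = q1 * p1 * q1 -> p1 * q2 * p1 = q2 * p1 * q2 ->
  p2 * q1 * p2 = q1 * p2 * q1 -> p2 * q2 * p2 = q2 * p2 * q2 ->
  q1 * q2 * p1 = p2 * (q1 * q2) -> q1 * q2 * p2 = p1 * (q1 * q2) ->
  q1 * (p1 * p2) = p1 * p2 * q2 -> q2 * (p1 * p2) = p1 * p2 * q1 ->
  let A := (1 + p1) * (1 + p2) in let B := (1 - q1) * (1 - q2) in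
  A * B * (A * B) = (A * B) *+ 12.
Proof.
move=> p1K p2K q1K q2K p12 q12 b11 b12 b21 b22 qqp1 qqp2 qpp1 qpp2 A B.
have AE : A = (1 + p2) * (1 + p1).
  by rewrite /A !mulrDl !mulrDr !mul1r !mulr1 p12 addrACA.
have D1M (p : R) : p * p = 1 -> (1 + p) * p = 1 + p.
  by move=> pK; rewrite mulrDl mul1r pK addrC.
have MB1 (q : R) : q * q = 1 -> q * (1 - q) = - (1 - q).
  by move=> qK; rewrite mulrBr mulr1 qK opprB.
have Ap1 : A * p1 = A by rewrite AE -mulrA D1M.
have Ap2 : A * p2 = A by rewrite /A -mulrA D1M.
have q1B x : x * q1 * B = - (x * B).
  by rewrite -mulrA /B [q1 * _]mulrA MB1 // mulNr mulrN.
have BE : B = (1 - q2) * (1 - q1).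
  by rewrite /B !mulrBl !mulrBr !mul1r !mulr1 q12 !opprB addrACA [- q2 - _]addrC addrACA.
have q2B x : x * q2 * B = - (x * B).
  by rewrite -mulrA BE [q2 * _]mulrA MB1 // mulNr mulrN.
(* The product is [qp - qpq + pqp - pqpq]; by the braid relation the middle terms cancel and
   [pqpq = qpqq = qp]. *)
have braid0 (p q : R) : q * q = 1 -> p * q * p = q * p * q ->
    (1 + p) * q * p * (1 - q) = 0.
  move=> qK b; rewrite mulrBr mulr1 !mulrDl !mul1r b -[_ * q * q]mulrA qK mulr1.
  by rewrite [q * p + _]addrC subrr.
have A11 : A * q1 * p1 * B = 0.
  have := braid0 _ _ q1K b11; rewrite AE /B => /(congr1 (fun z => (1 + p2) * z * (1 - q2))).
  by rewrite mulr0 mul0r !mulrA => ->.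
have A12 : A * q1 * p2 * B = 0.
  have := braid0 _ _ q1K b21; rewrite /A /B => /(congr1 (fun z => (1 + p1) * z * (1 - q2))).
  by rewrite mulr0 mul0r !mulrA => ->.
have A21 : A * q2 * p1 * B = 0.
  have := braid0 _ _ q2K b12; rewrite AE BE => /(congr1 (fun z => (1 + p2) * z * (1 - q1))).
  by rewrite mulr0 mul0r !mulrA => ->.
have A22 : A * q2 * p2 * B = 0.
  have := braid0 _ _ q2K b22; rewrite /A BE => /(congr1 (fun z => (1 + p1) * z * (1 - q1))).
  by rewrite mulr0 mul0r !mulrA => ->.
have qqpp : q1 * q2 * (p1 * p2) = p2 * p1 * (q1 * q2).
  by rewrite mulrA qqp1 -mulrA qqp2 mulrA.
(* Wherever the relations allow it, the row factors are moved to the left, next to [A], and the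
   column factors to the right, next to [B]. *)
have BA : B * A = (1 + p1 + p2 + p1 * p2) - (q1 + q1 * p1 + q1 * p2 + p1 * p2 * q2)
    - (q2 + q2 * p1 + q2 * p2 + p1 * p2 * q1)
    + (q1 * q2 + p2 * (q1 * q2) + p1 * (q1 * q2) + p2 * p1 * (q1 * q2)).
  have -> : A = 1 + p1 + p2 + p1 * p2.
    by rewrite /A mulrDl mul1r mulrDr mulr1 addrACA !addrA.
  have -> : B = 1 - q1 - q2 + q1 * q2.
    rewrite /B mulrBl mul1r mulrBr mulr1 opprB [q1 * _ - _]addrC !addrA.
    by rewrite [1 - _ - _]addrAC.
  rewrite !mulrDl mul1r !mulNr -qqpp -qqp1 -qqp2 -qpp1 -qpp2.
  by rewrite !mulrDr !mulr1.
(* With [A] and [B] opaque, distributivity expands only the middle product [B A]. *)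
clearbody A B.
rewrite mulrA -[A * B * A]mulrA BA.
rewrite !(mulrDr, mulrBr, mulrN) !(mulrDl, mulrBl, mulNr) !mulrA !mulr1.
do 8!rewrite ?Ap1 ?Ap2 ?q1B ?q2B ?A11 ?A12 ?A21 ?A22 ?mulNr ?opprK.
rewrite !(addr0, oppr0, opprD, opprK).
set M := A * B; by rewrite !addrA -mulr2n -!mulrSr.
Qed.

(** [k] stands for the row or the column number. It separates [X] into two pairs, so its stabilizer
    is the Klein group generated by the two transpositions. *)
Lemma sum_pair_stab (V : nmodType) (T : finType) (X : {set T}) (k : T -> nat)
    (a b c d : T) (f : {perm T} -> V) :
  uniq [:: a; b; c; d] -> X =i [:: a; b; c; d] ->
  k a = k b -> k c = k d -> k a != k c ->
  \sum_(s in [set s in Sym X | [forall x in X, k (s x) == k x]]) f s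
    = f 1%g + f (tperm a b) + f (tperm c d) + f (tperm a b * tperm c d)%g.
Proof.
move=> U XE kab kcd kac.
have [Xa Xb Xc Xd] : [/\ a \in X, b \in X, c \in X & d \in X].
  by rewrite !XE !inE !eqxx !orbT.
move: U; rewrite /= !inE !negb_or !andbT => /andP[/and3P[ab ac ad] /andP[/andP[bc bd] cd]].
pose r := [:: 1; tperm a b; tperm c d; tperm a b * tperm c d]%g.
have tE : (tperm a b * tperm c d)%g a = b /\ (tperm a b * tperm c d)%g c = d.
  by rewrite !permM tpermL (tpermD ac bc) tpermL tpermD // eq_sym.
(* The images of [a] and [c] already tell the four permutations apart. *)
have Ur : uniq r.
  apply: (@map_uniq _ _ (fun s : {perm T} => (s a, s c))).
  rewrite /= !perm1 !tE.1 !tE.2 !tpermL (tpermD ac bc) tpermD 1?[_ == a]eq_sym //.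
  by rewrite !inE !xpair_eqE !eqxx (negPf ab) (negPf cd) ![_ == a]eq_sym (negPf ab) ?andbF.
have kab_t x : k (tperm a b x) = k x by case: tpermP => // ->.
have kcd_t x : k (tperm c d x) = k x by case: tpermP => // ->.
have ab_out x : x \notin X -> tperm a b x = x.
  by rewrite XE !inE !negb_or => /and4P[xa xb _ _]; rewrite tpermD // eq_sym.
have cd_out x : x \notin X -> tperm c d x = x.
  by rewrite XE !inE !negb_or => /and4P[_ _ xc xd]; rewrite tpermD // eq_sym.
rewrite (eq_bigl (mem r)); last first.
  move=> s; rewrite inE /=; apply/idP/idP; last first.
    move=> rs; apply/andP; split.
      rewrite inE; apply/subsetP=> x; rewrite inE; apply: contraR => nXx.
      move: rs; rewrite !inE => /or4P[] /eqP->;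
        by rewrite ?permM ?perm1 ?ab_out ?cd_out.
    apply/forall_inP=> x _; move: rs; rewrite !inE.
    by case/or4P=> /eqP->; rewrite ?permM ?perm1 ?kcd_t ?kab_t.
  case/andP=> /[!inE] Xs /forall_inP ks.
  have sX x : x \in X -> [|| s x == a, s x == b, s x == c | s x == d].
    by move=> Xx; have := perm_closed x Xs; rewrite Xx XE !inE.
  have s_ab x : x \in X -> k x = k a -> (s x == a) || (s x == b).
    move=> Xx kx; have := ks x Xx; rewrite kx; have := sX x Xx.
    by case/or4P=> /eqP->; rewrite ?eqxx ?orbT //= ?kcd -?kcd eq_sym (negPf kac).
  have s_cd x : x \in X -> k x = k c -> (s x == c) || (s x == d).
    move=> Xx kx; have := ks x Xx; rewrite kx; have := sX x Xx.
    by case/or4P=> /eqP->; rewrite ?eqxx ?orbT //= -?kab (negPf kac).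
  have s_neq x y : x != y -> s x != s y by rewrite (inj_eq perm_inj).
  have permX (t : {perm T}) : (forall x, x \notin X -> t x = x) ->
      s a = t a -> s b = t b -> s c = t c -> s d = t d -> s = t.
    move=> tX sa sb sc sd; apply/permP=> x.
    case: (boolP (x \in X)) => [|nXx]; last by rewrite tX // (out_perm Xs).
    by rewrite XE !inE => /or4P[] /eqP->.
  have ba : b != a by rewrite eq_sym.
  have dc : d != c by rewrite eq_sym.
  have := s_ab a Xa erefl; have := s_ab b Xb (esym kab).
  have := s_cd c Xc erefl; have := s_cd d Xd (esym kcd).
  have := s_neq a b ab; have := s_neq c d cd.
  (* Of the 16 choices of images, injectivity on each pair leaves four. *)
  move=> + + /orP[] /eqP sd /orP[] /eqP sc /orP[] /eqP sb /orP[] /eqP sa;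
    rewrite sa sb sc sd ?eqxx //= => _ _.
  - suff -> : s = (tperm a b * tperm c d)%g by rewrite eqxx !orbT.
    apply: permX => [x nXx||||]; first by rewrite permM ab_out ?cd_out.
    + by rewrite tE.1.
    + by rewrite permM tpermR tpermD // eq_sym.
    + by rewrite tE.2.
    + by rewrite permM (tpermD ad bd) tpermR.
  - suff -> : s = tperm c d by rewrite eqxx !orbT.
    apply: permX => //; rewrite ?tpermL ?tpermR ?tpermD // eq_sym //.
  - suff -> : s = tperm a b by rewrite eqxx !orbT.
    by apply: permX => //; rewrite ?tpermL ?tpermR ?tpermD.
  - suff -> : s = 1%g by rewrite eqxx.
    by apply: permX => [x _||||]; rewrite perm1.
by rewrite -big_uniq //= !big_cons big_nil addr0 !addrA.
Qed.

(** * Transpositions in the group algebra *)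

Lemma galg_of1 (K : comNzRingType) (gT : finGroupType) :
  galg_of K (1%g : gT) = 1.
Proof. by []. Qed.

Lemma galg_ofM (K : comNzRingType) (gT : finGroupType) (g h : gT) :
  galg_of K (g * h)%g = galg_of K g * galg_of K h.
Proof.
apply/ffunP=> k; rewrite !ffunE (bigD1 g) //= !ffunE eqxx mul1r.
rewrite big1 ?addr0 => [|i /negPf ig]; last by rewrite ffunE ig mul0r.
by rewrite -[in RHS](inj_eq (mulgI g)) mulKVg.
Qed.

Lemma galg_of_tpermK (K : comNzRingType) (T : finType) (a b : T) :
  galg_of K (tperm a b) * galg_of K (tperm a b) = 1.
Proof. by rewrite -galg_ofM tperm2. Qed.

(* The column factors come first: this is the Young symmetrizer of the tableau
   with rows a b and c d, with every group element inverted. *)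
Definition young22 (K : comNzRingType) (T : finType) (a b c d : T) :
    group_alg K {perm T} :=
  let t x y := galg_of K (tperm x y) in
  (1 - t b d) * (1 - t a c) * ((1 + t c d) * (1 + t a b)).

(** Both sides are conjugates of one transposition by the other, and equal (b c). *)
Lemma tperm_braid (T : finType) (a b c : T) :
  a != b -> a != c -> b != c ->
  (tperm a b * tperm a c * tperm a b = tperm a c * tperm a b * tperm a c)%g.
Proof.
move=> ab ac bc.
have -> : (tperm a b * tperm a c * tperm a b = tperm a c ^ tperm a b)%g.
  by rewrite conjgE tpermV mulgA.
have -> : (tperm a c * tperm a b * tperm a c = tperm a b ^ tperm a c)%g.
  by rewrite conjgE tpermV mulgA.
by rewrite !tpermJ !tpermL !tpermD // 1?eq_sym // tpermC.
Qed.

Lemma tperm_pairC (T : finType) (a b c d : T) : uniq [:: a; b; c; d] ->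
  (tperm a b * tperm c d = tperm c d * tperm a b)%g.
Proof.
rewrite /= !inE !negb_or !andbT => /andP[/and3P[ab ac ad] /andP[/andP[bc bd] cd]].
by rewrite conjgC tpermJ !tpermD // eq_sym.
Qed.

(** Conjugation by (a c)(b d) exchanges the two rows of the tableau, hence (a b) and (c d). *)
Lemma tperm_pairJ (T : finType) (a b c d : T) : uniq [:: a; b; c; d] ->
  (tperm a c * tperm b d * tperm a b = tperm c d * (tperm a c * tperm b d))%g.
Proof.
rewrite /= !inE !negb_or !andbT => /andP[/and3P[ab ac ad] /andP[/andP[bc bd] cd]].
rewrite [RHS]conjgC tpermJ !permM (tpermD ad cd) !tpermR.
by rewrite (tpermD (x := b)) // eq_sym.
Qed.

Lemma expand_young22 (R : pzRingType) (p1 p2 q1 q2 : R) :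
  (1 + p1) * (1 + p2) * ((1 - q1) * (1 - q2)) =
    (1 - q1 - q2 + q1 * q2)
    + (p1 - p1 * q1 - p1 * q2 + p1 * (q1 * q2))
    + (p2 - p2 * q1 - p2 * q2 + p2 * (q1 * q2))
    + (p1 * p2 - p1 * p2 * q1 - p1 * p2 * q2 + p1 * p2 * (q1 * q2)).
Proof.
rewrite [(1 - q1) * _]mulrBr mulr1 mulrBl mul1r opprB [q1 * q2 - q2]addrC addrA.
rewrite [(1 + p1) * (1 + p2)]mulrDr mulr1 [(1 + p1) * p2]mulrDl mul1r addrA.
by rewrite !mulrDl mul1r !mulrDr !mulr1 !mulrN.
Qed.

(** This is the preceding expansion in the converse ring, where products are read backwards.
    Inverting group elements in the Young symmetrizer reverses its factors in this way. *)
Lemma expand_young22_rev (R : pzRingType) (p1 p2 q1 q2 : R) :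
  (1 - q2) * (1 - q1) * ((1 + p2) * (1 + p1)) =
    (1 - q1 - q2 + q2 * q1)
    + (p1 - q1 * p1 - q2 * p1 + q2 * q1 * p1)
    + (p2 - q1 * p2 - q2 * p2 + q2 * q1 * p2)
    + (p2 * p1 - q1 * (p2 * p1) - q2 * (p2 * p1) + q2 * q1 * (p2 * p1)).
Proof. exact: (@expand_young22 R^c). Qed.

(** * The character element of shape (2,2) *)

Section ShapeTwoTwo.
Variables (F : fieldType) (T : finType) (X : {set T}) (a b c d : T).
Hypothesis enumX : enum X = [:: a; b; c; d].

Let XE : X =i [:: a; b; c; d].
Proof. by move=> x; rewrite -mem_enum enumX. Qed.

Let U : uniq [:: a; b; c; d].
Proof. by rewrite -enumX enum_uniq. Qed.

Let neqs : [/\ [/\ a != b, a != c & a != d], b != c, b != d & c != d].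
Proof.
move: U; rewrite /= !inE !negb_or !andbT.
by move=> /andP[/and3P[ab ac ad] /andP[/andP[bc bd] cd]].
Qed.

Let Xidx : [/\ index a (enum X) = 0, index b (enum X) = 1,
  index c (enum X) = 2 & index d (enum X) = 3]%N.
Proof.
case: neqs => -[ab ac ad] bc bd cd.
by rewrite enumX /= !eqxx (negPf ab) (negPf ac) (negPf ad) (negPf bc)
  (negPf bd) (negPf cd).
Qed.

Lemma sum_row_stab22 (V : nmodType) (f : {perm T} -> V) :
  \sum_(p in row_stab part22 X) f p
    = f 1%g + f (tperm a b) + f (tperm c d) + f (tperm a b * tperm c d)%g.
Proof.
case: Xidx => ia ib ic id.
by apply: sum_pair_stab => //; rewrite /tab_row ?ia ?ib ?ic ?id.
Qed.

Lemma sum_col_stab22 (V : nmodType) (f : {perm T} -> V) :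
  \sum_(q in col_stab part22 X) f q
    = f 1%g + f (tperm a c) + f (tperm b d) + f (tperm a c * tperm b d)%g.
Proof.
case: Xidx => ia ib ic id; case: neqs => -[ab ac ad] bc bd cd.
apply: sum_pair_stab => //; rewrite /tab_col ?ia ?ib ?ic ?id //.
  by rewrite /= !inE !negb_or ab ac ad bd cd eq_sym bc.
by move=> x; rewrite XE !inE; congr (_ || _); rewrite orbCA.
Qed.

Lemma sum_specht_char22 : 12%:R != 0 :> F ->
  \sum_(s in Sym X) specht_char F part22 X s *: galg_of F s
    = 12%:R^-1 *: \sum_(g in Sym X) young22 F (g a) (g b) (g c) (g d).
Proof.
case: neqs => -[ab ac ad] bc bd cd nz12.
have U2 : uniq [:: a; c; b; d].
  by rewrite /= !inE !negb_or ab ac ad bd cd eq_sym bc.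
have U3 : uniq [:: c; d; a; b].
  by rewrite /= !inE !negb_or cd ab ![_ == a]eq_sym ac ad ![_ == b]eq_sym bc bd.
have U4 : uniq [:: b; d; a; c].
  by rewrite /= !inE !negb_or bd bc ac ![_ == a]eq_sym ab ad eq_sym cd.
rewrite (sum_specht_char nz12); last first.
  pose aG := regular_repr F (Sym X).
  have GX x y : x \in X -> y \in X -> tperm x y \in Sym X.
    move=> Xx Xy; rewrite inE; apply/subsetP=> z; rewrite inE.
    by case: tpermP => [->|->|] //; rewrite eqxx.
  have [Xa Xb Xc Xd] : [/\ a \in X, b \in X, c \in X & d \in X].
    by rewrite !XE !inE !eqxx !orbT.
  have aGM x y : x \in Sym X -> y \in Sym X -> aG (x * y)%g = aG x * aG y :> 'M_#|Sym X|.
    by move=> Gx Gy; rewrite repr_mxM.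
  set A := \sum_(p in _) _.
  have -> : A = (1 + aG (tperm a b)) * (1 + aG (tperm c d)) *
               ((1 - aG (tperm a c)) * (1 - aG (tperm b d))) :> 'M_#|Sym X|.
    rewrite /A sum_row_stab22 !sum_col_stab22 /=.
    rewrite !odd_permM !odd_tperm ac bd !odd_perm1 /= expr0 expr1 !scale1r !scaleN1r.
    rewrite !mul1g !mulg1 expand_young22.
    have aG1 := repr_mx1 aG; rewrite /= in aG1 aGM.
    by rewrite aG1 !aGM ?groupM ?GX.
  (* The row transpositions are (a b), (c d) and the column ones (a c), (b d); the required
     relations then hold already in the group. *)
  rewrite scaler_nat; apply: young_symmetrizer22_sq; rewrite -!aGM ?groupM ?GX //.
  1-4: by rewrite tperm2 repr_mx1.
  1-10: congr (aG _).
  - exact: tperm_pairC.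
  - exact: tperm_pairC.
  - exact: tperm_braid.
  - by rewrite [tperm a b]tpermC tperm_braid // eq_sym.
  - by rewrite [tperm a c]tpermC tperm_braid // eq_sym.
  - by rewrite [tperm c d]tpermC [tperm b d]tpermC tperm_braid // eq_sym.
  - exact: tperm_pairJ.
  - by rewrite [tperm a c]tpermC [tperm b d]tpermC tperm_pairJ // U3.
  - by rewrite [tperm a b]tpermC [tperm c d]tpermC tperm_pairJ // U4.
  - by rewrite tperm_pairJ.
congr (_ *: _); apply: eq_bigr => g Gg.
rewrite sum_row_stab22 !sum_col_stab22 /=.
rewrite !odd_permM !odd_tperm ac bd !odd_perm1 /= expr0 expr1 !scale1r !scaleN1r.
rewrite !(mul1g, mulg1, invMg, tpermV, invg1, conjMg, conj1g, tpermJ).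
rewrite !galg_ofM galg_of1 /young22 expand_young22_rev.
by []. Qed.
End ShapeTwoTwo.

(** * Sums over distinct indices *)

(** [g] is determined by its values at the four elements of [X], and these form an arbitrary
    ordering of [X]. The set [X] survives only in a condition on the quadruple, which later allows
    summing over [X] first. *)
Lemma sum_Sym4 (T : finType) (V : zmodType) (X : {set T}) (a b c d : T)
    (f : T -> T -> T -> T -> V) : enum X = [:: a; b; c; d] ->
  \sum_(g in Sym X) f (g a) (g b) (g c) (g d) =
  \sum_w \sum_x \sum_y \sum_z
    f w x y z *+ (uniq [:: z; y; x; w] && (X == [set w; x; y; z])).
Proof.
move=> enumX.
have XE : X =i [:: a; b; c; d] by move=> u; rewrite -mem_enum enumX.
have U : uniq [:: a; b; c; d] by rewrite -enumX enum_uniq.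
pose h (g : {perm T}) := (g a, g b, g c, g d).
pose P (p : T * T * T * T) := let: (w, x, y, z) := p in
  uniq [:: z; y; x; w] && (X == [set w; x; y; z]).
have exP p : P p -> exists2 g, g \in Sym X & h g = p.
  case: p => [[[w x] y] z] /= /andP[Up /eqP Xp].
  have {}Up : uniq [:: w; x; y; z] by rewrite -rev_uniq.
  have Xp' u : (u \in X) = (u \in [:: w; x; y; z]) by rewrite Xp !inE -!orbA.
  (* Outside [X] the index is 4, beyond the list, so the default [u] makes [phi] fix the
     complement. *)
  pose phi u := nth u [:: w; x; y; z] (index u [:: a; b; c; d]).
  have phiX u : (phi u \in X) = (u \in X).
    rewrite [RHS]XE -index_mem; case: ltnP => [lt_u|ge_u].
      by rewrite Xp' mem_nth.
    by rewrite /phi nth_default // XE -index_mem ltnNge ge_u.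
  have phi_inj : injective phi.
    move=> u v eq_uv; have := phiX v; rewrite -eq_uv phiX XE XE -!index_mem.
    move: eq_uv; rewrite /phi; case: ltnP => [lt_u|ge_u] eq_uv lt_v; last first.
      move: eq_uv; rewrite !nth_default //.
      by rewrite leqNgt -lt_v.
    move: eq_uv; rewrite (set_nth_default v) // => /eqP.
    rewrite nth_uniq -?lt_v // => /eqP eq_i.
    by rewrite -(nth_index v (x := v) (s := [:: a; b; c; d])) -?index_mem -?lt_v // -eq_i
      nth_index -?index_mem.
  exists (perm phi_inj).
    rewrite inE; apply/subsetP=> u; rewrite inE permE; apply: contraR => nXu.
    by rewrite /phi nth_default // leqNgt index_mem -XE.
  rewrite /h !permE /phi.
  have idx i := index_uniq a (i := i) (s := [:: a; b; c; d]).
  have /= ia := idx 0%N isT U; have /= ib := idx 1%N isT U.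
  have /= ic := idx 2%N isT U; have /= id := idx 3%N isT U.
  by rewrite ia ib ic id.
have PS g : g \in Sym X -> P (h g).
  rewrite inE => Sg; rewrite /P /h; apply/andP; split.
    have -> : [:: g d; g c; g b; g a] = rev (map g [:: a; b; c; d]) by [].
    by rewrite rev_uniq map_inj_uniq //; apply: perm_inj.
  apply/eqP/setP=> u; rewrite -[u](permKV g) (perm_closed _ Sg) XE !inE.
  by rewrite !(inj_eq perm_inj) -!orbA.
have h_inj : {in Sym X &, injective h}.
  move=> g1 g2 /[!inE] S1 S2 [ga gb gc gd]; apply/permP=> u.
  case: (boolP (u \in X)) => [|nXu]; last by rewrite !(out_perm _ nXu).
  by rewrite XE !inE => /or4P[] /eqP->.
(* The default 1 keeps the values of [h'] in [Sym X] even off the image of [h]. *)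
pose h' p := odflt 1%g [pick g in Sym X | h g == p].
transitivity (\sum_(p | P p) f p.1.1.1 p.1.1.2 p.1.2 p.2).
  rewrite (reindex_onto h h') => [|p /exP[g Gg hg]]; last first.
    rewrite /h'; case: pickP => [g' /andP[_ /eqP] //|/(_ g)].
    by rewrite /= Gg hg eqxx.
  apply: eq_bigl => g; apply/idP/andP=> [Gg|[Phg /eqP<-]].
    split; first exact: PS.
    rewrite /h'; case: pickP => [g' /andP[Gg' /eqP hg']|/(_ g)] /=.
      by apply/eqP/h_inj.
    by rewrite Gg eqxx.
  by rewrite /h'; case: pickP => [g' /andP[]//|_]; rewrite group1.
rewrite pair_bigA /= pair_bigA /= pair_bigA /= big_mkcond /=.
apply: eq_bigr => -[[[w x] y] z] _ /=; rewrite mulrb; done.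
Qed.

#[local] Arguments uniq : simpl never.

Section DistinctSums.
Variables (T : finType) (V : zmodType).

(** Distinctness is a 0-1 multiplicity, so the sums range over all indices and can be exchanged
    freely. The innermost index heads the list, so that [cons_uniq] isolates the condition on it. *)
Definition sum2 (f : T -> T -> V) :=
  \sum_a \sum_b f a b *+ uniq [:: b; a].
Definition sum3 (f : T -> T -> T -> V) :=
  \sum_a \sum_b \sum_c f a b c *+ uniq [:: c; b; a].
Definition sum4 (f : T -> T -> T -> T -> V) :=
  \sum_a \sum_b \sum_c \sum_d f a b c d *+ uniq [:: d; c; b; a].

Lemma sum_notin (s : seq T) (f : T -> V) : uniq s ->
  \sum_x f x = \sum_x f x *+ (x \notin s) + \sum_(x <- s) f x.
Proof.
move=> Us; rewrite [X in _ + X]big_uniq // [X in _ + X]big_mkcond -big_split.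
by apply: eq_bigr => x _ /=; case: (x \in s); rewrite ?add0r ?addr0.
Qed.

(** This eliminates the innermost index of a sum over distinct indices. *)
Lemma sum_uniq_cons (s : seq T) (f : T -> V) :
  \sum_x f x *+ uniq (x :: s) = (\sum_x f x - \sum_(x <- s) f x) *+ uniq s.
Proof.
case: (boolP (uniq s)) => Us; last first.
  by rewrite mulr0n big1 // => x _; rewrite cons_uniq (negPf Us) andbF.
rewrite (sum_notin f Us) addrK mulr1n.
by apply: eq_bigr => x _; rewrite cons_uniq Us andbT.
Qed.

Lemma eq_sum4 f g : (forall a b c d, uniq [:: d; c; b; a] ->
  f a b c d = g a b c d) -> sum4 f = sum4 g.
Proof.
move=> fg; do 4!apply: eq_bigr => ? _.
by case: (boolP (uniq _)) => // /fg->.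
Qed.

Lemma eq_sum3 f g : (forall a b c, uniq [:: c; b; a] ->
  f a b c = g a b c) -> sum3 f = sum3 g.
Proof.
move=> fg; do 3!apply: eq_bigr => ? _.
by case: (boolP (uniq _)) => // /fg->.
Qed.

Lemma eq_sum2 f g : (forall a b, uniq [:: b; a] ->
  f a b = g a b) -> sum2 f = sum2 g.
Proof.
move=> fg; do 2!apply: eq_bigr => ? _.
by case: (boolP (uniq _)) => // /fg->.
Qed.

Lemma sum4D f g : sum4 (fun a b c d => f a b c d + g a b c d) = sum4 f + sum4 g.
Proof.
rewrite /sum4 -big_split; do 3!(apply: eq_bigr => ? _; rewrite -big_split).
by apply: eq_bigr => ? _; rewrite mulrnDl.
Qed.

Lemma sum4N f : sum4 (fun a b c d => - f a b c d) = - sum4 f.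
Proof.
rewrite /sum4 -sumrN; do 3!(apply: eq_bigr => ? _; rewrite -sumrN).
by apply: eq_bigr => ? _; rewrite mulNrn.
Qed.

Lemma sum3D f g : sum3 (fun a b c => f a b c + g a b c) = sum3 f + sum3 g.
Proof.
rewrite /sum3 -big_split; do 2!(apply: eq_bigr => ? _; rewrite -big_split).
by apply: eq_bigr => ? _; rewrite mulrnDl.
Qed.

Lemma sum3N f : sum3 (fun a b c => - f a b c) = - sum3 f.
Proof.
rewrite /sum3 -sumrN; do 2!(apply: eq_bigr => ? _; rewrite -sumrN).
by apply: eq_bigr => ? _; rewrite mulNrn.
Qed.

Lemma sum2D f g : sum2 (fun a b => f a b + g a b) = sum2 f + sum2 g.
Proof.
rewrite /sum2 -big_split; apply: eq_bigr => ? _; rewrite -big_split.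
by apply: eq_bigr => ? _; rewrite mulrnDl.
Qed.

Lemma sum2N f : sum2 (fun a b => - f a b) = - sum2 f.
Proof.
rewrite /sum2 -sumrN; apply: eq_bigr => ? _; rewrite -sumrN.
by apply: eq_bigr => ? _; rewrite mulNrn.
Qed.

Lemma sum4_swap12 f : sum4 f = sum4 (fun a b => f b a).
Proof.
rewrite /sum4 exchange_big; do 4!apply: eq_bigr => ? _.
congr (_ *+ nat_of_bool _); apply/perm_uniq/seq.permP=> p /=.
by do 2!congr (_ + _)%N; rewrite addnCA.
Qed.

Lemma sum4_swap23 f : sum4 f = sum4 (fun a b c => f a c b).
Proof.
apply: eq_bigr => ? _; rewrite exchange_big; do 3!apply: eq_bigr => ? _.
congr (_ *+ nat_of_bool _); apply/perm_uniq/seq.permP=> p /=.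
by congr (_ + _)%N; rewrite addnCA.
Qed.

Lemma sum4_swap34 f : sum4 f = sum4 (fun a b c d => f a b d c).
Proof.
do 2!apply: eq_bigr => ? _; rewrite exchange_big; do 2!apply: eq_bigr => ? _.
by congr (_ *+ nat_of_bool _); apply/perm_uniq/seq.permP=> p /=; rewrite addnCA.
Qed.

Lemma sum3_swap12 f : sum3 f = sum3 (fun a b => f b a).
Proof.
rewrite /sum3 exchange_big; do 3!apply: eq_bigr => ? _.
congr (_ *+ nat_of_bool _); apply/perm_uniq/seq.permP=> p /=.
by congr (_ + _)%N; rewrite addnCA.
Qed.

Lemma sum3_swap23 f : sum3 f = sum3 (fun a b c => f a c b).
Proof.
apply: eq_bigr => ? _; rewrite exchange_big; do 2!apply: eq_bigr => ? _.
by congr (_ *+ nat_of_bool _); apply/perm_uniq/seq.permP=> p /=; rewrite addnCA.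
Qed.

(** The pairs (a, b) and (c, d) share no index, exactly one index (in four ways), or both (in two
    ways). *)
Lemma sum2_square f :
  \sum_a \sum_b \sum_c \sum_d f a b c d *+ uniq [:: b; a] *+ uniq [:: d; c] =
  sum4 f + sum3 (fun a b c => f a b a c + f a b b c + f a b c a + f a b c b)
    + sum2 (fun a b => f a b a b + f a b b a).
Proof.
rewrite /sum4 /sum3 /sum2 -!big_split; apply: eq_bigr => a _.
rewrite -!big_split; apply: eq_bigr => b _ /=.
case: (boolP (uniq [:: b; a])) => [Uba|nUba]; last first.
  rewrite !big1 ?addr0 // => c _.
  - by rewrite cons_uniq (negPf nUba) andbF.
  - by rewrite big1 // => d _; rewrite 2!(cons_uniq, mem_seq1) (negPf nUba) !andbF.
  - by rewrite big1 // => d _; rewrite mul0rn.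
under eq_bigr => c _ do under eq_bigr => d _ do rewrite mulr1n.
have ba : b != a by move: Uba; rewrite cons_uniq inE andbT.
have ab : a != b by rewrite eq_sym.
have swap_ab d : uniq [:: d; a; b] = uniq [:: d; b; a].
  by rewrite !cons_uniq !inE !andbT ba ab orbC.
(* Here the third index equals [x], one of [a] and [b]; the fourth is then the other one, [y], or
   lies outside both. *)
have E x y : x != y -> \sum_d f a b x d *+ uniq [:: d; x]
   = \sum_d f a b x d *+ uniq [:: d; x; y] + f a b x y.
  move=> xy; rewrite !sum_uniq_cons !big_cons !big_nil !addr0 !cons_uniq inE xy.
  by rewrite !mulr1n opprD addrA subrK.
rewrite (sum_notin _ Uba) !big_cons big_nil addr0 (E b a) // (E a b) //.
under [X in _ + (_ + (X + _))]eq_bigr => d _ do rewrite swap_ab.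
have -> : \sum_x (\sum_d f a b x d *+ uniq [:: d; x]) *+ (x \notin [:: b; a])
   = \sum_c \sum_d f a b c d *+ uniq [:: d; c; b; a]
     + \sum_c (f a b c a + f a b c b) *+ uniq [:: c; b; a].
  rewrite -big_split; apply: eq_bigr => c _ /=.
  rewrite !sum_uniq_cons [uniq [:: c; b; a]]cons_uniq Uba andbT -mulrnDl.
  congr (_ *+ _); rewrite !big_cons big_nil addr0 mulr1n.
  by rewrite addr0 [f a b c b + _]addrC opprD [_ + (- _ - _)]addrA subrK.
rewrite -!addrA; congr (_ + _).
have -> : \sum_c (f a b a c + f a b b c + f a b c a + f a b c b) *+ uniq [:: c; b; a]
   = \sum_c f a b a c *+ uniq [:: c; b; a]
     + (\sum_c f a b b c *+ uniq [:: c; b; a]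
        + \sum_c (f a b c a + f a b c b) *+ uniq [:: c; b; a]).
  by rewrite -!big_split; apply: eq_bigr => c _ /=; rewrite -!mulrnDl !addrA.
by rewrite mulr1n !addrA [LHS](ACl (4*2*1*5*3)).
Qed.
End DistinctSums.

(** * Quadruple sums with weights of total zero *)

Section ZeroSum.
Variables (T : finType) (K : comNzRingType) (L : algType K).
Variables (t : T -> T -> L) (y : T -> K).
(** [t a b] models the transposition (a b). [t_rot] compares factorizations of a 3-cycle, [t_mid]
    those of a 4-cycle, and [t_V4] multiplies two double transpositions into the third. *)
Hypothesis tC : forall a b, t a b = t b a.
Hypothesis t_sq : forall a b, t a b * t a b = 1.
Hypothesis t_rot : forall a b c, uniq [:: c; b; a] ->
  t a b * t b c = t b c * t c a.
Hypothesis t_mid : forall a b c d, uniq [:: d; c; b; a] ->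
  t a c * (t c d * t a b) = t c d * t a b * t b d.
Hypothesis t_V4 : forall a b c d, uniq [:: d; c; b; a] ->
  t b d * t a c * (t c d * t a b) = t a d * t b c.
Hypothesis sum_y : \sum_a y a = 0.

Let S4 (f : T -> T -> T -> T -> L) :=
  sum4 (fun a b c d => (y a * y b * y c * y d) *: f a b c d).

Let S4_swap12 f : S4 f = S4 (fun a b => f b a).
Proof.
rewrite /S4 sum4_swap12; apply: eq_sum4 => a b c d _.
by rewrite [y b * y a]mulrC.
Qed.

Let S4_swap23 f : S4 f = S4 (fun a b c => f a c b).
Proof.
rewrite /S4 sum4_swap23; apply: eq_sum4 => a b c d _.
by rewrite [y a * y c * y b]mulrAC.
Qed.

Let S4_swap34 f : S4 f = S4 (fun a b c d => f a b d c).
Proof.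
rewrite /S4 sum4_swap34; apply: eq_sum4 => a b c d _.
by rewrite [_ * y d * y c]mulrAC.
Qed.

Let eq_S4 f g : (forall a b c d, uniq [:: d; c; b; a] ->
  f a b c d = g a b c d) -> S4 f = S4 g.
Proof. by move=> fg; apply: eq_sum4 => a b c d /fg->. Qed.

Let S4D f g : S4 (fun a b c d => f a b c d + g a b c d) = S4 f + S4 g.
Proof.
by rewrite /S4 -sum4D; apply: eq_sum4 => a b c d _; rewrite scalerDr.
Qed.

Let S4N f : S4 (fun a b c d => - f a b c d) = - S4 f.
Proof.
by rewrite /S4 -sum4N; apply: eq_sum4 => a b c d _; rewrite scalerN.
Qed.

Let N0 := S4 (fun a b c d => 1).
Let N2 := S4 (fun a b c d => t a b * t c d).
Let N3 := S4 (fun a b c d => t a b * t b c).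

(* Every permutation of the four summation indices is a product of a prefix of
   swap12, a prefix of swap23 swap12 and a prefix of swap34 swap23 swap12. *)
Ltac swap12 := apply: (etrans (S4_swap12 _)).
Ltac swap23 := apply: (etrans (S4_swap23 _)).
Ltac swap34 := apply: (etrans (S4_swap34 _)).
Ltac permute2 :=
  first [reflexivity | swap34; first [reflexivity
    | swap23; first [reflexivity | swap12; reflexivity]]].
Ltac permute3 := first [permute2 | swap23; first [permute2 | swap12; permute2]].
Ltac permute_S4 := first [permute3 | swap12; permute3].

(** Renaming the indices identifies all terms of one cycle type. The 16 signed terms are the
    identity, transpositions with signs [- - + +], three double transpositions with sign [+], four
    3-cycles with sign [-], and 4-cycles with signs [+ + - -]. *)
Lemma sum4_young22 :
  S4 (fun a b c d => (1 - t b d) * (1 - t a c) * ((1 + t c d) * (1 + t a b)))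
  = N0 + N2 *+ 3 - N3 *+ 4.
Proof.
pose N1 := S4 (fun a b c d => t a b).
pose N4 := S4 (fun a b c d => t a b * t c d * t b c).
transitivity (
    (N0 - S4 (fun a b c d => t a c) - S4 (fun a b c d => t b d)
       + S4 (fun a b c d => t b d * t a c))
    + (N1 - S4 (fun a b c d => t a c * t a b) - S4 (fun a b c d => t b d * t a b)
       + S4 (fun a b c d => t b d * t a c * t a b))
    + (S4 (fun a b c d => t c d) - S4 (fun a b c d => t a c * t c d)
       - S4 (fun a b c d => t b d * t c d)
       + S4 (fun a b c d => t b d * t a c * t c d))
    + (S4 (fun a b c d => t c d * t a b)
       - S4 (fun a b c d => t a c * (t c d * t a b))
       - S4 (fun a b c d => t b d * (t c d * t a b))
       + S4 (fun a b c d => t b d * t a c * (t c d * t a b)))).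
  rewrite -!S4N -!S4D; apply: eq_S4 => a b c d _.
  exact: expand_young22_rev.
have E1 : S4 (fun a b c d => t a c) = N1 by permute_S4.
have E2 : S4 (fun a b c d => t b d) = N1 by permute_S4.
have E3 : S4 (fun a b c d => t c d) = N1 by permute_S4.
have E4 : S4 (fun a b c d => t b d * t a c) = N2 by permute_S4.
have E5 : S4 (fun a b c d => t c d * t a b) = N2 by permute_S4.
have E6 : S4 (fun a b c d => t b d * t a c * (t c d * t a b)) = N2.
  by rewrite (eq_S4 t_V4); permute_S4.
have E7 : S4 (fun a b c d => t a c * t a b) = N3.
  rewrite (eq_S4 (g := fun a b c d => t c a * t a b)); first by permute_S4.
  by move=> *; rewrite [t _ _]tC.
have E8 : S4 (fun a b c d => t b d * t a b) = N3.
  rewrite (eq_S4 (g := fun a b c d => t d b * t b a)); first by permute_S4.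
  by move=> *; congr (_ * _).
have E9 : S4 (fun a b c d => t a c * t c d) = N3 by permute_S4.
have E10 : S4 (fun a b c d => t b d * t c d) = N3.
  rewrite (eq_S4 (g := fun a b c d => t b d * t d c)); first by permute_S4.
  by move=> *; congr (_ * _).
have E11 : S4 (fun a b c d => t b d * t a c * t a b) = N4.
  rewrite (eq_S4 (g := fun a b c d => t d b * t a c * t b a)); first by permute_S4.
  by move=> *; congr (_ * _ * _).
have E12 : S4 (fun a b c d => t b d * t a c * t c d) = N4.
  rewrite (eq_S4 (g := fun a b c d => t b d * t c a * t d c)); first by permute_S4.
  by move=> *; congr (_ * _ * _).
have E13 : S4 (fun a b c d => t a c * (t c d * t a b)) = N4.
  rewrite (eq_S4 (g := fun a b c d => t c d * t b a * t d b)); first by permute_S4.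
  by move=> a b c d U; rewrite t_mid //; congr (_ * _ * _).
(* This is [t_mid] with [a], [b] exchanged and [c], [d] exchanged. *)
have E14 : S4 (fun a b c d => t b d * (t c d * t a b)) = N4.
  rewrite (eq_S4 (g := fun a b c d => t d c * t a b * t c a)); first by permute_S4.
  move=> a b c d U; rewrite [t c d]tC [t a b]tC t_mid; first by congr (_ * _ * _).
  apply: etrans U; apply/perm_uniq/seq.permP=> p /=.
  by rewrite addnCA; do 2!congr (_ + _)%N; rewrite addnCA.
rewrite E1 E2 E3 E4 E5 E6 E7 E8 E9 E10 E11 E12 E13 E14.
(* The reordering places the cancelling [N1] and [N4] terms side by side at the end. *)
rewrite !addrA [LHS](ACl (1*4*13*16*6*7*10*11*2*5*3*9*8*14*12*15)).
by rewrite /= !subrK !addrK !mulrS !mulr0n !addr0 !opprD !addrA.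
Qed.

(** As [y] sums to zero, an index that occurs only through its weight contributes minus the weights
    of the other indices. *)
Let sum4_collapse (f : T -> T -> T -> L) :
  sum4 (fun a b c d => y d *: f a b c)
    = - sum3 (fun a b c => (y a + y b + y c) *: f a b c).
Proof.
rewrite -sum3N; do 3!apply: eq_bigr => ? _.
rewrite sum_uniq_cons -scaler_suml sum_y scale0r add0r.
by rewrite !big_cons big_nil addr0 -!scalerDl addrC [y _ + y _]addrC.
Qed.

Let sum3_collapse (f : T -> T -> L) :
  sum3 (fun a b c => y c *: f a b) = - sum2 (fun a b => (y a + y b) *: f a b).
Proof.
rewrite -sum2N; do 2!apply: eq_bigr => ? _.
rewrite sum_uniq_cons -scaler_suml sum_y scale0r add0r.
by rewrite !big_cons big_nil addr0 -!scalerDl addrC.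
Qed.

Let sum2_collapse (f : T -> L) :
  sum2 (fun a b => y b *: f a) = - \sum_a y a *: f a.
Proof.
rewrite -sumrN; apply: eq_bigr => ? _.
rewrite sum_uniq_cons -scaler_suml sum_y scale0r add0r.
by rewrite big_cons big_nil addr0.
Qed.

(** Rotating the indices fixes [f] and permutes the three weights, so these contribute equally. *)
Let sum3_cyclic (f : T -> T -> T -> L) :
    (forall a b c, uniq [:: c; b; a] -> f b c a = f a b c) ->
  sum3 (fun a b c => (y a + y b + y c) *: f a b c)
    = sum3 (fun a b c => y b *: f a b c) *+ 3.
Proof.
have sum3_rot (g : T -> T -> T -> L) : sum3 g = sum3 (fun a b c => g b c a).
  by rewrite sum3_swap23 sum3_swap12.
move=> fr; rewrite mulrSr mulr2n.
rewrite [X in _ + X + _]sum3_rot [X in _ + X]sum3_rot [X in _ + X]sum3_rot.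
rewrite -!sum3D; apply: eq_sum3 => a b c U.
have U' : uniq [:: b; a; c] by move: U; rewrite -(rot_uniq 1).
by rewrite (fr _ _ _ U) -(fr c a b) // -!scalerDl [_ + y a]addrC addrA.
Qed.

Let K3 := sum3 (fun a b c => (y a * y b ^+ 2 * y c) *: (t a b * t b c)).

(** The index [d] is absent from the 3-cycle and is eliminated; by [t_rot] the rest is invariant
    under rotation, and the weight of the middle index may stand for all three. *)
Let N3E : N3 = - (K3 *+ 3).
Proof.
pose f a b c := (y a * y b * y c) *: (t a b * t b c).
have -> : N3 = sum4 (fun a b c d => y d *: f a b c).
  by apply: eq_sum4 => a b c d _; rewrite /f scalerA [y d * _]mulrC.
rewrite sum4_collapse sum3_cyclic => [|a b c U].
  congr (- (_ *+ _)); apply: eq_sum3 => a b c _.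
  by rewrite /f scalerA; congr (_ *: _); ring.
by rewrite /f -(t_rot U) [_ * y a]mulrC mulrA.
Qed.

Let p2 := \sum_a y a ^+ 2.
Let p4 := \sum_a y a ^+ 4.

Let sum2_sqr : sum2 (fun a b => (y a ^+ 2 * y b ^+ 2) *: (1 : L)) = (p2 ^+ 2 - p4) *: 1.
Proof.
rewrite [p2 ^+ 2]expr2 mulr_suml -sumrB scaler_suml; apply: eq_bigr => a _.
rewrite sum_uniq_cons -scaler_suml -mulr_sumr big_cons big_nil addr0 -scalerBl.
by rewrite mulr1n -exprD.
Qed.

(** This is Newton's formula for [24 e_4(y)] in power sums, with [p_1 = 0]. The indices are
    eliminated one after another. *)
Let N0E : N0 = (p2 ^+ 2 *+ 3 - p4 *+ 6) *: 1.
Proof.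
pose f a b c : L := (y a * y b * y c) *: 1.
have -> : N0 = sum4 (fun a b c d => y d *: f a b c).
  by apply: eq_sum4 => a b c d _; rewrite /f scalerA [y d * _]mulrC.
rewrite sum4_collapse sum3_cyclic => [|a b c _]; last first.
  by rewrite /f [_ * y a]mulrC mulrA.
rewrite sum3_swap12.
have -> : sum3 (fun a b c => y a *: f b a c)
   = sum3 (fun a b c => y c *: ((y a ^+ 2 * y b) *: (1 : L))).
  by apply: eq_sum3 => a b c _; rewrite /f !scalerA; congr (_ *: _); ring.
rewrite sum3_collapse.
have -> : sum2 (fun a b => (y a + y b) *: ((y a ^+ 2 * y b) *: (1 : L)))
   = sum2 (fun a b => y b *: (y a ^+ 3 *: (1 : L)))
     + sum2 (fun a b => (y a ^+ 2 * y b ^+ 2) *: (1 : L)).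
  rewrite -sum2D; apply: eq_sum2 => a b _; rewrite !scalerA -scalerDl.
  by congr (_ *: _); ring.
rewrite sum2_collapse sum2_sqr.
have -> : \sum_a y a *: (y a ^+ 3 *: (1 : L)) = p4 *: 1.
  by rewrite scaler_suml; apply: eq_bigr => a _; rewrite scalerA -exprS.
by rewrite mulNrn opprK -scaleNr -scalerDl scalerMnl; congr (_ *: _); ring.
Qed.

(** The square is [N2 + 4 K3 + 2 (p2^2 - p4)], while the left side is [N0 + 3 N2 - 4 N3] with
    [N0 = 3 p2^2 - 6 p4] and [N3 = -3 K3]. *)
Lemma sum4_young22_sq :
  S4 (fun a b c d => (1 - t b d) * (1 - t a c) * ((1 + t c d) * (1 + t a b)))
  = (sum2 (fun a b => (y a * y b) *: t a b) ^+ 2 - p2 ^+ 2 *: 1) *+ 3.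
Proof.
pose f a b c d := (y a * y b * y c * y d) *: (t a b * t c d).
have -> : sum2 (fun a b => (y a * y b) *: t a b) ^+ 2 =
    \sum_a \sum_b \sum_c \sum_d f a b c d *+ uniq [:: b; a] *+ uniq [:: d; c].
  rewrite expr2 /sum2 mulr_suml; apply: eq_bigr => a _.
  rewrite mulr_suml; apply: eq_bigr => b _.
  rewrite mulr_sumr; apply: eq_bigr => c _.
  rewrite mulr_sumr; apply: eq_bigr => d _.
  by rewrite mulrnAl mulrnAr -scalerAl -scalerAr scalerA mulrA mulrnAC.
rewrite sum2_square.
have -> : sum3 (fun a b c => f a b a c + f a b b c + f a b c a + f a b c b) = K3 *+ 4.
  pose k a b c := (y a * y b ^+ 2 * y c) *: (t a b * t b c).
  (* In each of the four cases the shared index becomes the middle one: it is [a] in the first and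
     third, [b] in the second and fourth. *)
  have KS : K3 = sum3 (fun a b => k b a) by rewrite -sum3_swap12.
  rewrite mulrSr mulrSr mulr2n {1}KS [in X in _ = _ + X + _]KS -!sum3D.
  apply: eq_sum3 => a b c _; rewrite /f /k [t c a]tC [t c b]tC [t b a]tC.
  by congr (_ *: _ + _ *: _ + _ *: _ + _ *: _); ring.
have -> : sum2 (fun a b => f a b a b + f a b b a) = (p2 ^+ 2 - p4) *: 1 *+ 2.
  rewrite mulr2n -sum2_sqr -sum2D; apply: eq_sum2 => a b _.
  by rewrite /f [t b a]tC t_sq; congr (_ *: _ + _ *: _); ring.
rewrite sum4_young22 N0E N3E -[sum4 f]/N2 mulNrn opprK.
rewrite mulrnBl [(_ + _ + _) *+ 3]mulrnDl [(N2 + _) *+ 3]mulrnDl -!mulrnA !scalerMnl.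
rewrite -[RHS]addrA -scalerBl -addrA addrC.
by congr (_ + _ *: _); ring.
Qed.

End ZeroSum.

(** * The Pluecker coordinate *)

Lemma uniq_rev4 (T : eqType) (a b c d : T) : uniq [:: d; c; b; a] ->
  [/\ [/\ a != b, a != c & a != d], b != c, b != d & c != d].
Proof.
rewrite !cons_uniq !inE !negb_or !andbT.
case/and3P=> /and3P[dc db da] /andP[cb ca] ba.
by split; first split; rewrite eq_sym.
Qed.

Lemma tperm_rot (T : finType) (a b c : T) : uniq [:: c; b; a] ->
  (tperm a b * tperm b c = tperm b c * tperm c a)%g.
Proof.
rewrite !cons_uniq !inE !negb_or !andbT => /andP[/andP[cb ca] ba].
by rewrite conjgC tpermJ tpermL tpermD // [tperm a c]tpermC.
Qed.

Lemma tperm_mid (T : finType) (a b c d : T) : uniq [:: d; c; b; a] ->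
  (tperm a c * (tperm c d * tperm a b) = tperm c d * tperm a b * tperm b d)%g.
Proof.
case/uniq_rev4=> -[ab ac ad] bc bd cd.
rewrite conjgC tpermJ !permM tpermL (tpermD (z := a)) 1?eq_sym // tpermL.
by rewrite (tpermD (z := d)).
Qed.

Lemma tperm_V4 (T : finType) (a b c d : T) : uniq [:: d; c; b; a] ->
  (tperm b d * tperm a c * (tperm c d * tperm a b) = tperm a d * tperm b c)%g.
Proof.
move=> U; rewrite -mulgA tperm_mid //; case/uniq_rev4: U => -[ab ac ad] bc bd cd.
have {1}-> : tperm b d = (tperm b d)^-1%g by rewrite tpermV.
rewrite -conjgE conjMg !tpermJ !tpermL !tpermR !tpermD // 1?eq_sym //.
rewrite [tperm c b]tpermC; apply: tperm_pairC.
by rewrite !cons_uniq !inE !negb_or bc bd cd ad [b == a]eq_sym [c == a]eq_sym ab ac.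
Qed.

(** The product over the complement of [X] is the full product divided by the four values on [X].
    Each quadruple of distinct indices comes from exactly one set [X]. *)
Lemma plucker22E (F : fieldType) (n : nat) (u : 'I_n -> F) :
  12%:R != 0 :> F -> (forall a, u a != 0) ->
  plucker part22 u =
    ((\prod_a u a) / 12%:R) *: sum4 (fun a b c d =>
      ((u a)^-1 * (u b)^-1 * (u c)^-1 * (u d)^-1) *: young22 F a b c d).
Proof.
move=> nz12 nzu; rewrite /plucker.
pose w (X : {set 'I_n}) := \prod_(a in ~: X) u a.
transitivity (\sum_(X : {set 'I_n} | #|X| == 4) \sum_a \sum_b \sum_c \sum_d
    ((w X / 12%:R) *: young22 F a b c d)
      *+ (uniq [:: d; c; b; a] && (X == [set a; b; c; d]))).
  apply: eq_bigr => X cardX.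
  have [a [b [c [d enumX]]]] : exists a b c d, enum X = [:: a; b; c; d].
    move: cardX; rewrite cardE; case: (enum X) => [|a [|b [|c [|d [|]]]]] //.
    by move=> _; exists a, b, c, d.
  rewrite (sum_specht_char22 enumX nz12) scalerA scaler_sumr.
  exact: (sum_Sym4 (fun a b c d => (w X / 12%:R) *: young22 F a b c d) enumX).
rewrite /sum4 scaler_sumr exchange_big; apply: eq_bigr => a _.
rewrite scaler_sumr exchange_big; apply: eq_bigr => b _.
rewrite scaler_sumr exchange_big; apply: eq_bigr => c _.
rewrite scaler_sumr exchange_big; apply: eq_bigr => d _ /=.
case: (boolP (uniq [:: d; c; b; a])) => Uabcd; last first.
  by rewrite mulr0n scaler0 big1 // => X _; rewrite (negPf Uabcd).
set Y := [set a; b; c; d].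
have YE : Y = [set:: [:: d; c; b; a]].
  by apply/setP=> x; rewrite !inE; do !case: eqP.
have cardY : #|Y| == 4 by rewrite YE cardsE (card_uniqP Uabcd).
rewrite (bigD1 Y) //= eqxx big1 => [|X /andP[_ /negPf->]]; last by [].
rewrite addr0 !mulr1n scalerA; congr (_ *: _).
have -> : \prod_x u x = w Y * (u d * u c * u b * u a).
  rewrite (bigID (mem Y)) /= mulrC; congr (_ * _).
    by apply: eq_bigl => x; rewrite in_setC.
  rewrite (eq_bigl (mem [:: d; c; b; a])) => [|x]; last by rewrite YE inE.
  by rewrite -big_uniq // !big_cons big_nil /= mulr1 !mulrA.
(* With the inverse of 12 an opaque scalar, only values of [u] occur as denominators. *)
by move: (12%:R^-1) => k; field; rewrite !nzu.
Qed.

Lemma sum_neq_sym (V : zmodType) (m : nat) (f : 'I_m -> 'I_m -> V) :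
  (forall i j, f i j = f j i) ->
  \sum_i \sum_(j | j != i) f i j
    = (\sum_(i < m) \sum_(j < m | (i < j)%N) f i j) *+ 2.
Proof.
move=> fC; rewrite mulr2n [X in _ = _ + X](exchange_big_dep predT) //=.
rewrite -big_split; apply: eq_bigr => i _.
rewrite (bigID (fun j : 'I_m => (i < j)%N)) /=; congr (_ + _).
  by apply: eq_bigl => j; rewrite andbC neq_ltn orbC; case: ltnP.
apply: eq_big => j; last by rewrite fC.
by rewrite neq_ltn -leqNgt; case: ltngtP.
Qed.

(** * The point u and its inverse coordinates *)

Section UPoint.
Variables (F : fieldType) (m : nat) (x : 'I_m -> F).
Hypothesis nz_x : forall i, x i != 0.
Hypothesis nz_S : \sum_i x i != 0.
Let y a := (upoint x a)^-1.

Lemma upoint_neq0 a : upoint x a != 0.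
Proof. by rewrite /upoint; case: unlift => [i|]; rewrite ?oppr_eq0 invr_eq0. Qed.

Let y_lift i : y (lift ord_max i) = x i.
Proof. by rewrite /y /upoint liftK invrK. Qed.

Let y_max : y ord_max = - \sum_i x i.
Proof. by rewrite /y /upoint unlift_none invrN invrK. Qed.

Lemma sum_upointV : \sum_a y a = 0.
Proof.
rewrite (bigD1_ord ord_max) //= y_max; under eq_bigr => i _ do rewrite y_lift.
by rewrite addNr.
Qed.

(** The last index contributes the square of the sum of the [x i], that is, all squares once more
    and every mixed product twice. *)
Lemma sum_upointV_sqr : \sum_a y a ^+ 2 = omega x *+ 2.
Proof.
rewrite (bigD1_ord ord_max) //= y_max; under eq_bigr => i _ do rewrite y_lift.
rewrite sqrrN /omega mulrnDl -sum_neq_sym; last by move=> *; rewrite mulrC.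
rewrite mulr2n addrAC; congr (_ + _).
rewrite expr2 mulr_suml -big_split; apply: eq_bigr => i _ /=.
by rewrite mulr_sumr (bigD1 i) //= expr2.
Qed.

(** Ordered pairs count each transposition twice; those involving the last index carry the negative
    weight [- S x_i]. *)
Lemma sum2_upointV :
  sum2 (fun a b => (y a * y b) *: galg_of F (tperm a b)) = - (transp_elt x *+ 2).
Proof.
have E a : \sum_b (y a * y b) *: galg_of F (tperm a b) *+ uniq [:: b; a]
    = \sum_b (y a * y b) *: galg_of F (tperm a b) *+ (b != a).
  by apply: eq_bigr => b _; rewrite cons_uniq inE andbT.
rewrite /sum2 (eq_bigr _ (fun a _ => E a)).
pose S := \sum_i x i.
pose R := \sum_i x i *: galg_of F (tperm (lift ord_max i) ord_max).
pose Q := \sum_(i < m) \sum_(j < m | (i < j)%N)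
       (x i * x j) *: galg_of F (tperm (lift ord_max i) (lift ord_max j)).
rewrite (bigD1_ord ord_max) //=.
have -> : \sum_b (y ord_max * y b) *: galg_of F (tperm ord_max b) *+ (b != ord_max)
   = - (S *: R).
  rewrite (bigD1_ord ord_max) //= eqxx mulr0n add0r /R scaler_sumr -sumrN.
  apply: eq_bigr => i _; rewrite eq_sym neq_lift mulr1n y_max y_lift.
  by rewrite tpermC mulNr scaleNr scalerA.
have -> : \sum_i \sum_b (y (lift ord_max i) * y b) *:
     galg_of F (tperm (lift ord_max i) b) *+ (b != lift ord_max i)
   = - (S *: R) + Q *+ 2.
  rewrite /Q -sum_neq_sym; last by move=> i j; rewrite tpermC mulrC.
  rewrite /R scaler_sumr -sumrN -big_split; apply: eq_bigr => i _ /=.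
  rewrite (bigD1_ord ord_max) //= neq_lift mulr1n y_max y_lift; congr (_ + _).
    by rewrite mulrN scaleNr scalerA mulrC.
  rewrite [RHS]big_mkcond; apply: eq_bigr => j _.
  by rewrite y_lift (inj_eq lift_inj) mulrb.
by rewrite -[transp_elt x]/(S *: R - Q) mulrnBl opprB addrA -opprD -mulr2n addrC.
Qed.
End UPoint.

Lemma plucker22_upoint (F : fieldType) (m : nat) (x : 'I_m -> F) :
  12%:R != 0 :> F -> (forall i, x i != 0) -> \sum_i x i != 0 ->
  (- (1 / \prod_a upoint x a)) *: plucker part22 (upoint x)
    = omega x ^+ 2 *: 1 - transp_elt x ^+ 2.
Proof.
move=> nz12 nz_x nz_S; have nz_u := upoint_neq0 nz_x nz_S.
have nz_prod : \prod_a upoint x a != 0 by apply/prodf_neq0.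
rewrite plucker22E // scalerA.
have -> : - (1 / \prod_a upoint x a) * (\prod_a upoint x a / 12%:R) = - 12%:R^-1.
  by rewrite mul1r mulNr mulrA mulVf // mul1r.
rewrite /young22 (sum4_young22_sq (y := fun a => (upoint x a)^-1)
  (t := fun a b => galg_of F (tperm a b))).
(* The values [-2 T] and [2 omega] give a factor 4 after squaring; with the 3 of the quadruple sum
   it cancels the 12. *)
- rewrite sum2_upointV sum_upointV_sqr sqrrN -scaler_nat.
  rewrite [(transp_elt x *+ 2) ^+ 2]exprMn_n [(omega x *+ 2) ^+ 2]exprMn_n.
  rewrite -[(omega x ^+ 2 *+ _) *: 1]scalerMnl -mulrnBl -scaler_nat !scalerA.
  have -> : - (12%:R)^-1 * 3%:R * (2 ^ 2)%:R = - 1 :> F.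
    by rewrite -mulrA -natrM mulNr mulVf.
  by rewrite scaleN1r opprB.
- by move=> a b; rewrite tpermC.
- by move=> a b; rewrite galg_of_tpermK.
- move=> a b c U; rewrite -!galg_ofM; congr galg_of.
  exact: tperm_rot.
- move=> a b c d U; rewrite -!galg_ofM; congr galg_of.
  exact: tperm_mid.
- move=> a b c d U; rewrite -!galg_ofM; congr galg_of.
  exact: tperm_V4.
- exact: sum_upointV.
Qed.

Local Open Scope complex_scope.

Theorem proposition4p2 (R : realType) (m : nat) (x : 'I_m -> R)
    (hn : (2 <= m.+1)%N) (hx : forall i, 0 < x i) :
  let xC : 'I_m -> R[i] := fun i => (x i)%:C in
  let u : 'I_m.+1 -> R[i] := upoint xC in
  (- (1 / \prod_(a < m.+1) u a)) *: plucker part22 u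
    = omega xC ^+ 2 *: 1 - transp_elt xC ^+ 2.
Proof.
move=> xC u; apply: plucker22_upoint; first by rewrite pnatr_eq0.
- by move=> i; rewrite /xC fmorph_eq0 lt0r_neq0.
(* Since [n >= 2], at least one positive [x i] is present, so their sum is positive and hence
   nonzero. *)
case: m hn x hx @xC @u => // m _ x hx xC u.
rewrite -(rmorph_sum (real_complex R)) /=.
rewrite fmorph_eq0 lt0r_neq0 // big_ord_recl ltr_pwDl ?sumr_ge0 // => i _.
exact: Order.POrderTheory.ltW.
Qed.
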